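(* Let $\mathfrak D=\{\lambda\in\mathbb C:\operatorname{Re}(\lambda)>0\}$ and let $\mathcal P,\mathcal G\subseteq\mathcal H$ be two commuting subclasses of the class $\mathcal H$ of real symmetric positive definite $n\times n$ matrices, i.e. $\mathbf P\mathbf G=\mathbf G\mathbf P$ for all $\mathbf P\in\mathcal P$, $\mathbf G\in\mathcal G$. Let $\mathbf A$ be a real $n\times n$ matrix. If there exists a matrix $\mathbf P\in\mathcal P$ such that $$\mathbf W:=\mathbf P\mathbf A+\mathbf A^T\mathbf P$$ is positive definite, then $\mathbf A$ is both multiplicative and additive $(\mathfrak D,\mathcal G)$-stable; that is, $\sigma(\mathbf G\mathbf A)\subset\mathfrak D$ and $\sigma(\mathbf G+\mathbf A)\subset\mathfrak D$ for every $\mathbf G\in\mathcal G$.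
   Context: $\sigma(\mathbf A)\subset\mathbb C$ denotes the spectrum (set of complex eigenvalues) of a real $n\times n$ matrix $\mathbf A$. For a set $\mathfrak D\subseteq\mathbb C$ closed under complex conjugation, a class $\mathcal G$ of real $n\times n$ matrices and a binary operation $\circ$ on real $n\times n$ matrices, $\mathbf A$ is $(\mathfrak D,\mathcal G,\circ)$-stable if $\sigma(\mathbf G\circ\mathbf A)\subset\mathfrak D$ for every $\mathbf G\in\mathcal G$. Multiplicative (respectively additive) $(\mathfrak D,\mathcal G)$-stability is the case where $\circ$ is matrix multiplication (respectively matrix addition). *)

(* Defs.v *)
From mathcomp Require Export all_boot all_order all_algebra.
From mathcomp Require Export sesquilinear complex classical_sets reals.

Set Implicit Arguments.
Unset Strict Implicit.
Unset Printing Implicit Defensive.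

Import Order.TTheory GRing.Theory Num.Theory.

Local Open Scope classical_set_scope.
Local Open Scope ring_scope.
Local Open Scope complex_scope.

(* [eigenvalue] is defined through row eigenvectors, v *m B = z *: v; for a
   square matrix these are exactly the roots of the characteristic polynomial
   ([eigenvalue_root_char]), hence the usual eigenvalues. *)
Definition spectrum (R : realType) (n : nat) (A : 'M[R]_n) : set R[i] :=
  [set z | eigenvalue (map_mx (real_complex R) A) z].

Definition open_right_half_plane (R : realType) : set R[i] :=
  [set z | 0 < complex.Re z].

Arguments open_right_half_plane : clear implicits.

(* [stable] is meant for regions [D] that are closed under conjugation. *)
Lemma open_right_half_plane_conj (R : realType) (z : R[i]) :
  open_right_half_plane R z -> open_right_half_plane R (conjc z).
Proof. by case: z. Qed.

Definition stable (R : realType) (n : nat) (D : set R[i]) (G : set 'M[R]_n)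
    (op : 'M[R]_n -> 'M[R]_n -> 'M[R]_n) (A : 'M[R]_n) : Prop :=
  forall M : 'M[R]_n, G M -> spectrum (op M A) `<=` D.

Definition multiplicative_stable (R : realType) (n : nat) (D : set R[i])
    (G : set 'M[R]_n) (A : 'M[R]_n) : Prop :=
  stable D G (fun M B => M *m B) A.

Definition additive_stable (R : realType) (n : nat) (D : set R[i])
    (G : set 'M[R]_n) (A : 'M[R]_n) : Prop :=
  stable D G (fun M B => M + B) A.

Definition sym_posdef (R : realType) (n : nat) : set 'M[R]_n :=
  [set A | A \is symmetricmx /\
           forall x : 'cV[R]_n, x != 0 -> 0 < (x^T *m A *m x) 0 0].

Arguments sym_posdef : clear implicits.

Definition commuting_classes (R : realType) (n : nat)
    (P G : set 'M[R]_n) : Prop :=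
  forall M N : 'M[R]_n, P M -> G N -> M *m N = N *m M.

(* Main.v *)
(* If [S] and [S B + B^T S] are positive definite, every eigenvalue [z] of [B]
   satisfies [z + z^* > 0] (Lyapunov). For [B = G A] take [S = P G^-1], which
   gives [S B + B^T S = W]; for [B = G + A] take [S = P], which gives
   [2 P G + W]. Both [P G^-1] and [P G] are positive definite, as products of
   commuting positive definite matrices. *)
Require Import Defs.
From mathcomp Require Import spectral.

Set Implicit Arguments.
Unset Strict Implicit.
Unset Printing Implicit Defensive.

Import Order.TTheory GRing.Theory Num.Theory.

Local Open Scope classical_set_scope.
Local Open Scope ring_scope.
Local Open Scope sesquilinear_scope.

Lemma eigenvalue_trmx (F : fieldType) (n : nat) (A : 'M[F]_n) :
  eigenvalue A^T =1 eigenvalue A.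
Proof.
move=> a; rewrite !eigenvalue_root_char /char_poly -[in RHS]det_tr.
by rewrite /char_poly_mx linearB /= tr_scalar_mx map_trmx.
Qed.

(** Positivity is taken in the order of [C], so it also says that the form has real values. Row
    vectors match the row eigenvectors of [eigenvalue]. *)
Definition posdef_form (C : numClosedFieldType) (n : nat) (M : 'M[C]_n) :=
  forall v : 'rV[C]_n, v != 0 -> 0 < (v *m M *m v^t*) 0 0.

Lemma trmxC_mul (C : numClosedFieldType) (m n p : nat)
    (A : 'M[C]_(m, n)) (B : 'M[C]_(n, p)) : (A *m B)^t* = B^t* *m A^t*.
Proof. by rewrite trmx_mul map_mxM. Qed.

(** For a row eigenvector [v] of [B^t*], conjugation gives [B v^t* = z^* v^t*], so the form of
    [B^t* S + S B] at [v] is [z + z^*] times the positive form of [S] at [v]. *)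
Lemma lyapunov_eigenvalue (C : numClosedFieldType) (n : nat)
    (S B : 'M[C]_n) (z : C) :
  posdef_form S -> posdef_form (B^t* *m S + S *m B) -> eigenvalue (B^t*) z ->
  0 < z + z^*.
Proof.
move=> posS posW /eigenvalueP [v vB v0].
have Bv : B *m v^t* = z^* *: v^t*.
  by rewrite -[B]trmxCK -trmxC_mul vB linearZ /= map_mxZ.
have := posW v v0.
rewrite mulmxDr mulmxDl mulmxA vB -[v *m (S *m B) *m _]mulmxA -mulmxA.
rewrite -[S *m B *m _]mulmxA Bv -!(scalemxAr, scalemxAl) -scalerDl mxE mulmxA.
by rewrite pmulr_lgt0 // posS.
Qed.

(* The square root [S] of [P] is obtained by spectral decomposition; it commutes
   with [Q] because [Q] does with [P], so that [P *m Q = S *m Q *m S]. *)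
Lemma posdef_form_mul (C : numClosedFieldType) (n : nat) (P Q : 'M[C]_n) :
  P \is hermsymmx -> posdef_form P -> posdef_form Q -> P *m Q = Q *m P ->
  posdef_form (P *m Q).
Proof.
move=> hP posP posQ PQ v v0.
have /orthomx_spectralP := hermitian_normalmx hP.
set U := spectralmx P; set d := spectral_diag P => defP.
have unitU : U \in unitmx by apply: spectral_unit.
have invU : invmx U = U^t* by apply/invmx_unitary/spectral_unitarymx.
have UP : U *m P *m invmx U = diag_mx d.
  by rewrite defP !mulmxA mulmxV // mul1mx mulmxK.
(* [d 0 i] is the value of the form of [P] at row [i] of [U], a row that is nonzero because [U] is
   invertible. *)
have d_gt0 i : 0 < d 0 i.
  have rU0 : row i U != 0.
    apply: contraTneq unitU => rU0; rewrite -row_free_unit.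
    apply/negP => /row_freeP [V] /(congr1 (row i)).
    rewrite row_mul rU0 mul0mx => /rowP /(_ i).
    by rewrite !mxE eqxx => /eqP; rewrite eq_sym oner_eq0.
  have := posP _ rU0; rewrite -row_mul tr_row map_col -invU.
  suff -> : row i (U *m P) *m col i (invmx U) = (d 0 i)%:M.
    by rewrite mxE eqxx mulr1n.
  apply/matrixP => j k; rewrite !ord1 [RHS]mxE eqxx mulr1n.
  have /matrixP /(_ i i) := UP; rewrite [RHS]mxE eqxx mulr1n => <-.
  by rewrite !mxE; apply: eq_bigr => l _; rewrite !mxE.
pose e := map_mx sqrtC d.
pose S := invmx U *m diag_mx e *m U.
have SS : S *m S = P.
  rewrite /S !mulmxA mulmxK // -[_ *m diag_mx e *m diag_mx e]mulmxA.
  rewrite [RHS]defP; congr (_ *m _ *m _).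
  apply/matrixP => i j; rewrite mul_diag_mx !mxE mulrnAr.
  by rewrite -expr2 sqrtCK.
have SC : S^t* = S.
  rewrite /S !trmxC_mul invU trmxCK mulmxA tr_diag_mx map_diag_mx.
  congr (_ *m diag_mx _ *m _); apply/rowP => i; rewrite !mxE.
  by apply/CrealP/ger0_real; rewrite sqrtC_ge0 ltW.
have SQ : S *m Q = Q *m S.
  pose H := U *m Q *m invmx U.
  have defQ : Q = invmx U *m H *m U by rewrite /H !mulmxA mulVmx // mul1mx mulmxKV.
  have dH : diag_mx d *m H = H *m diag_mx d.
    by rewrite -UP /H !mulmxA !mulmxKV // -[U *m P *m Q]mulmxA PQ mulmxA.
  (* Entrywise, [dH] reads [d_i H_ij = H_ij d_j]: either [H_ij = 0] or [d_i = d_j], and in both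
     cases the same identity holds for the square roots. *)
  clearbody H; have {dH} eH : diag_mx e *m H = H *m diag_mx e.
    apply/matrixP => i j; have /matrixP /(_ i j) := dH.
    rewrite !mul_diag_mx !mul_mx_diag !mxE [_ * d 0 j]mulrC [_ * sqrtC _]mulrC.
    have [-> |H0] := eqVneq (H i j) 0; first by rewrite !mulr0.
    by move=> /(mulIf H0) ->.
  rewrite /S defQ !mulmxA !mulmxK //.
  by rewrite -[invmx U *m diag_mx e *m H]mulmxA eH mulmxA.
have vS0 : v *m S != 0.
  apply: contraTneq (posP v v0) => vS.
  by rewrite -SS mulmxA vS !mul0mx mxE ltxx.
have := posQ _ vS0.
by rewrite trmxC_mul SC -SS -[S *m S *m Q]mulmxA SQ !mulmxA.
Qed.

Lemma hermsymmx_real_complex (R : realType) (n : nat) (M : 'M[R]_n) :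
  M \is symmetricmx -> map_mx (real_complex R) M \is hermsymmx.
Proof.
move=> /is_hermitianmxP; rewrite !expr0 scale1r map_mx_id // => symM.
apply/is_hermitianmxP; rewrite expr0 scale1r; apply/matrixP => i j.
by rewrite {1}symM !mxE [RHS]conjc_real.
Qed.

Lemma sym_posdefD (R : realType) (n : nat) (A B : 'M[R]_n) :
  sym_posdef R n A -> sym_posdef R n B -> sym_posdef R n (A + B).
Proof.
move=> [symA posA] [symB posB]; split=> [|x x0].
  move: symA symB => /is_hermitianmxP symA /is_hermitianmxP symB.
  apply/is_hermitianmxP; rewrite linearD /= map_mxD scalerDr.
  by rewrite -symA -symB.
by rewrite mulmxDr mulmxDl mxE addr_gt0 ?posA ?posB.
Qed.

Lemma sym_posdef_trmx (R : realType) (n : nat) (A : 'M[R]_n) :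
  sym_posdef R n A -> A^T = A.
Proof.
by move=> [/is_hermitianmxP symA _]; rewrite [RHS]symA expr0 scale1r map_mx_id.
Qed.

Lemma trmx_symmetricmx (R : realType) (n : nat) (A : 'M[R]_n) :
  A^T = A -> A \is symmetricmx.
Proof.
by move=> AT; apply/is_hermitianmxP; rewrite expr0 scale1r map_mx_id ?AT.
Qed.

Lemma sym_posdef_unit (R : realType) (n : nat) (A : 'M[R]_n) :
  sym_posdef R n A -> A \in unitmx.
Proof.
move=> [_ posA]; rewrite -unitmx_tr -row_free_unit -kermx_eq0.
apply/rowV0P => v /sub_kermxP vA.
apply/eqP; apply: contraTT isT => v0.
have := posA v^T; rewrite trmx_eq0 trmxK => /(_ v0).
have -> : v *m A *m v^T = v *m (v *m A^T)^T by rewrite trmx_mul trmxK mulmxA.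
by rewrite vA trmx0 mulmx0 mxE ltxx.
Qed.

(** The form of [invmx A] at [x] is the form of [A] at [invmx A *m x]. *)
Lemma sym_posdef_inv (R : realType) (n : nat) (A : 'M[R]_n) :
  sym_posdef R n A -> sym_posdef R n (invmx A).
Proof.
move=> posdefA; have unitA := sym_posdef_unit posdefA.
have AT := sym_posdef_trmx posdefA.
split=> [|x x0]; first by apply: trmx_symmetricmx; rewrite trmx_inv AT.
have Ax0 : invmx A *m x != 0.
  by apply: contra_neq x0 => Ax; rewrite -[x](mulKVmx unitA) Ax mulmx0.
have := posdefA.2 _ Ax0.
by rewrite trmx_mul trmx_inv AT !mulmxA mulmxKV.
Qed.

(* For real [M] and [v = a + i b] the form is [a M a^T + b M b^T], the cross
   terms cancelling by symmetry. *)
Lemma sym_posdef_complex (R : realType) (n : nat) (M : 'M[R]_n) :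
  sym_posdef R n M -> posdef_form (map_mx (real_complex R) M).
Proof.
move=> posdefM v v0; have MT := sym_posdef_trmx posdefM.
pose a := map_mx (@complex.Re R) v; pose b := map_mx (@complex.Im R) v.
have vE : v = map_mx (real_complex R) a + 'i%C *: map_mx (real_complex R) b.
  by apply/rowP => i; rewrite !mxE -complexE.
have vC : v^t* = map_mx (real_complex R) a^T - 'i%C *: map_mx (real_complex R) b^T.
  apply/colP => i; rewrite !mxE; case: (v 0 i) => x y.
  by apply/eqP; rewrite eq_complex /=; simpc.
(* Both sides are 1 by 1, hence equal to their transposes, and [M] is symmetric. *)
have cross : b *m M *m a^T = a *m M *m b^T.
  by rewrite [LHS]mx11_scalar -tr_scalar_mx -mx11_scalar !trmx_mul trmxK MT mulmxA.
have -> : v *m map_mx (real_complex R) M *m v^t* =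
    map_mx (real_complex R) (a *m M *m a^T + b *m M *m b^T).
  rewrite vC {1}vE mulmxBr !mulmxDl -!(scalemxAl, scalemxAr) -!map_mxM cross.
  rewrite scalerA -expr2 sqr_i scaleN1r map_mxD.
  by rewrite opprD opprK addrA addrK.
have posM (w : 'rV_n) : w != 0 -> 0 < (w *m M *m w^T) 0 0.
  by move=> w0; have := posdefM.2 w^T; rewrite trmx_eq0 trmxK; apply.
have posM0 (w : 'rV_n) : 0 <= (w *m M *m w^T) 0 0.
  by have [->|/posM/ltW//] := eqVneq w 0; rewrite !mul0mx mxE.
rewrite mxE ltcR mxE.
(* Since [v] is nonzero, [a] or [b] is, and its term is positive while the other is nonnegative. *)
have [a0|/posM a0] := eqVneq a 0; last by rewrite ltr_pwDl.
rewrite ltr_wpDl // posM //; apply: contra_neq v0 => b0.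
by rewrite vE a0 b0 map_mx0 scaler0 addr0.
Qed.

(** Commutation makes the product symmetric. Positivity comes from the complex case, where the
    spectral theorem gives a square root, by restricting to real vectors. *)
Lemma sym_posdefM (R : realType) (n : nat) (P Q : 'M[R]_n) :
  sym_posdef R n P -> sym_posdef R n Q -> P *m Q = Q *m P ->
  sym_posdef R n (P *m Q).
Proof.
move=> posdefP posdefQ PQ; split=> [|x x0].
  apply: trmx_symmetricmx.
  by rewrite trmx_mul (sym_posdef_trmx posdefP) (sym_posdef_trmx posdefQ).
have := @posdef_form_mul _ _ (map_mx (real_complex R) P) (map_mx (real_complex R) Q).
rewrite -!map_mxM PQ => /(_ (hermsymmx_real_complex posdefP.1)
  (sym_posdef_complex posdefP) (sym_posdef_complex posdefQ) erefl).
move=> /(_ (map_mx (real_complex R) x^T)); rewrite map_mx_eq0 trmx_eq0 => /(_ x0).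
have -> : (map_mx (real_complex R) x^T)^t* = map_mx (real_complex R) x.
  by apply/colP => i; rewrite !mxE; apply: conjc_real.
by rewrite -!map_mxM mxE ltcR.
Qed.

Lemma lyapunov_spectrum (R : realType) (n : nat) (S B : 'M[R]_n) :
  sym_posdef R n S -> sym_posdef R n (S *m B + B^T *m S) ->
  spectrum B `<=` open_right_half_plane R.
Proof.
move=> posS posW z; rewrite /spectrum /= -eigenvalue_trmx.
have BC : (map_mx (real_complex R) B)^t* = (map_mx (real_complex R) B)^T.
  by apply/matrixP => i j; rewrite !mxE; apply: conjc_real.
rewrite -BC => /(lyapunov_eigenvalue (sym_posdef_complex posS)).
rewrite BC map_trmx -!map_mxM -map_mxD addrC => /(_ (sym_posdef_complex posW)).
rewrite /open_right_half_plane /=.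
(* A complex number is positive when its imaginary part vanishes and its real part is positive; here
   the real part is [x + x]. *)
case: z => x y; rewrite ltcE /= => /andP [_].
by rewrite -mulr2n pmulrn_lgt0.
Qed.

Theorem theorem13 (R : realType) (n : nat) (calP calG : set 'M[R]_n)
    (A : 'M[R]_n)
    (hP : calP `<=` sym_posdef R n) (hG : calG `<=` sym_posdef R n)
    (hcomm : commuting_classes calP calG)
    (hW : exists P : 'M[R]_n,
            calP P /\ sym_posdef R n (P *m A + A^T *m P)) :
  multiplicative_stable (open_right_half_plane R) calG A /\
  additive_stable (open_right_half_plane R) calG A.
Proof.
have [P [calPP posW]] := hW; have posP := hP P calPP.
split=> G calGG; have posG := hG G calGG; have PG := hcomm P G calPP calGG;
  have GT := sym_posdef_trmx posG.
- have unitG := sym_posdef_unit posG.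
  have PVG : P *m invmx G = invmx G *m P.
    by rewrite -[LHS](mulKmx unitG) [G *m _]mulmxA -PG mulmxK.
  apply: (@lyapunov_spectrum _ _ (P *m invmx G)).
    exact: sym_posdefM posP (sym_posdef_inv posG) PVG.
  (* Only the second [P G^-1] is swapped, so that [G] meets its inverse in both terms:
     [P G^-1 G A + A^T G G^-1 P = W]. *)
  by rewrite trmx_mul GT {2}PVG !mulmxA mulmxKV // mulmxK.
- apply: (lyapunov_spectrum posP).
  (* Regrouping yields [(P G + P G) + W]. *)
  rewrite [(G + A)^T]linearD /= GT mulmxDr mulmxDl -PG addrACA.
  have posPG := sym_posdefM posP posG PG.
  by apply: sym_posdefD posW; apply: sym_posdefD.
Qed.
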